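(* Let $f:\mathbb{R}^n\to\mathbb{R}$ be $L$-smooth and $\mu$-strongly convex with $\mu\ge0$ (merely convex if $\mu=0$), with a minimizer $x_*$. Let $m\ge1$, $\beta_1,\dots,\beta_m\in[0,1)$, $\beta_{\max}=\max_{1\le i\le m}\beta_i$, and let $\widetilde\beta,\hat\beta$ be the constants satisfying $$\frac1m\sum_{i=1}^m\frac{\beta_i}{(1-\beta_i)^2}=\frac{\widetilde\beta}{(1-\widetilde\beta)^2},\qquad\frac1m\sum_{i=1}^m\frac1{1-\beta_i}=\frac1{1-\hat\beta}.$$ Let $(x_k)_{k\ge0}$ be generated by the Aggregated Heavy-Ball method (AggHB) started at $x_0$ with momentum parameters $\beta_1,\dots,\beta_m$ and constant stepsize $\gamma_1=\dots=\gamma_m=\gamma$, where $$\gamma=\min\left\{\frac{(1-\beta_{\max})^2}{2\mu},\ \frac{1-\hat\beta}{4L},\ \frac{(1-\widetilde\beta)\sqrt{(1-\hat\beta)(1-\beta_{\max})}}{4\sqrt3\,L\sqrt{\widetilde\beta}}\right\}$$ (terms with zero denominator are read as $+\infty$). Put $R_0=\|x_0-x_*\|_2$, $F=\frac1m\sum_{i=1}^m\frac{\gamma_i}{1-\beta_i}=\frac{\gamma}{1-\hat\beta}$, $w_k=\left(1-\frac{\mu F}{2}\right)^{-(k+1)}$, $W_K=\sum_{k=0}^Kw_k$, and $\overline{x}_K=\frac1{W_K}\sum_{k=0}^Kw_kx_k$. Then, to achieve $f(\overline{x}_K)-f(x_* )\le\varepsilon$ for $\varepsilon>0$, AggHB requires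 $$\mathcal{O}\left(\left(\frac L\mu+\frac{1-\hat\beta}{(1-\beta_{\max})^2}+\frac{L\sqrt{\widetilde\beta(1-\hat\beta)}}{\mu(1-\widetilde\beta)\sqrt{1-\beta_{\max}}}\right)\cdot\ln\left(\frac{R_0^2}{\varepsilon}\cdot\left(L+\frac{1-\hat\beta}{(1-\beta_{\max})^2}+\frac{L\sqrt{\widetilde\beta(1-\hat\beta)}}{(1-\widetilde\beta)\sqrt{1-\beta_{\max}}}\right)\right)\right)$$ iterations when $\mu>0$, and $$\mathcal{O}\left(\frac{LR_0^2}{\varepsilon}+\frac{LR_0^2\sqrt{\widetilde\beta(1-\hat\beta)}}{\varepsilon(1-\widetilde\beta)\sqrt{1-\beta_{\max}}}\right)$$ iterations when $\mu=0$.
   Context: A differentiable function $f:\mathbb{R}^n\to\mathbb{R}$ is $L$-smooth if $\|\nabla f(x)-\nabla f(y)\|_2\le L\|x-y\|_2$ for all $x,y\in\mathbb{R}^n$, and $\mu$-strongly convex if $f(y)\ge f(x)+\langle\nabla f(x),y-x\rangle+\frac\mu2\|y-x\|_2^2$ for all $x,y\in\mathbb{R}^n$ (for $\mu=0$ this is convexity). Aggregated Heavy-Ball method (AggHB): given $x_0\in\mathbb{R}^n$, stepsizes $\gamma_i>0$ and momentum parameters $\beta_i$ ($i=1,\dots,m$), put $V_{-1}^{(i)}=0$ and, for $k=0,1,2,\dots$, $$V_k^{(i)}=\beta_iV_{k-1}^{(i)}+\nabla f(x_k)\quad(i=1,\dots,m),\qquad x_{k+1}=x_k-\frac1m\sum_{i=1}^m\gamma_iV_k^{(i)}.$$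 The numbers $\widetilde\beta,\hat\beta\in[0,1)$ are well defined because $t\mapsto t/(1-t)^2$ and $t\mapsto1/(1-t)$ are increasing bijections of $[0,1)$ onto $[0,\infty)$ and $[1,\infty)$ respectively. The notation $\mathcal{O}(\cdot)$ hides numerical constant factors. *)

(* Defs.v *)
From HB Require Import structures.
From mathcomp Require Import all_boot all_order all_algebra.
From mathcomp Require Import all_classical all_reals all_analysis.

Set Implicit Arguments.
Unset Strict Implicit.
Unset Printing Implicit Defensive.

Import Order.TTheory GRing.Theory Num.Theory.
Import numFieldNormedType.Exports.
Local Open Scope ring_scope.

Definition dotp (R : realType) (n : nat) (u v : 'rV[R]_n) : R :=
  \sum_(j < n) u 0 j * v 0 j.

(* The library norm [`|u|] on ['rV[R]_n] is the sup norm, hence [norm2]. *)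
Definition norm2 (R : realType) (n : nat) (u : 'rV[R]_n) : R :=
  Num.sqrt (dotp u u).

Definition grad (R : realType) (n : nat) (f : 'rV[R]_n -> R) (x : 'rV[R]_n) :
    'rV[R]_n :=
  \row_(j < n) 'd f x (delta_mx 0 j).

(* Differentiability does not depend on the choice of norm on ['rV[R]_n]. *)
Definition smooth (R : realType) (n : nat) (L : R) (f : 'rV[R]_n -> R) : Prop :=
  (forall x, differentiable f x) /\
  (forall x y, norm2 (grad f x - grad f y) <= L * norm2 (x - y)).

Definition strongly_convex (R : realType) (n : nat) (mu : R)
    (f : 'rV[R]_n -> R) : Prop :=
  (forall x, differentiable f x) /\
  (forall x y,
    f x + dotp (grad f x) (y - x) + mu / 2 * norm2 (y - x) ^+ 2 <= f y).

Definition is_minimizer (R : realType) (n : nat) (f : 'rV[R]_n -> R)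
    (xs : 'rV[R]_n) : Prop :=
  forall x, f xs <= f x.

(* [V i k] stands for V_k^(i). *)
Definition is_AggHB (R : realType) (n m : nat) (f : 'rV[R]_n -> R)
    (gamma beta : 'I_m -> R) (x0 : 'rV[R]_n) (x : nat -> 'rV[R]_n) : Prop :=
  exists V : 'I_m -> nat -> 'rV[R]_n,
    [/\ x 0%N = x0,
        (* the case k = 0 of the recursion, with V_{-1}^(i) = 0 *)
        forall i, V i 0%N = beta i *: 0 + grad f (x 0%N),
        forall i k, V i k.+1 = beta i *: V i k + grad f (x k.+1) &
        forall k, x k.+1 = x k - m%:R^-1 *: \sum_(i < m) gamma i *: V i k].

(* The neutral element 0 is harmless: the [beta i] are nonnegative. *)
Definition beta_max (R : realType) (m : nat) (beta : 'I_m -> R) : R :=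
  \big[Num.max/0]_(i < m) beta i.

(* Division in [\bar R] satisfies [0^-1 = +oo], so that a term whose
   denominator vanishes is [+oo]. *)
Definition aggHB_stepsize (R : realType) (L mu bmax bt bh : R) : \bar R :=
  (Order.min (((1 - bmax) ^+ 2)%:E / (2 * mu)%:E)
    (Order.min ((1 - bh)%:E / (4 * L)%:E)
       (((1 - bt) * Num.sqrt ((1 - bh) * (1 - bmax)))%:E
         / (4 * Num.sqrt 3 * L * Num.sqrt bt)%:E)))%E.

Definition weight (R : realType) (mu F : R) (k : nat) : R :=
  (1 - mu * F / 2) ^- k.+1.

Definition weight_sum (R : realType) (mu F : R) (K : nat) : R :=
  \sum_(0 <= k < K.+1) weight mu F k.

Definition weighted_avg (R : realType) (n : nat) (mu F : R)
    (x : nat -> 'rV[R]_n) (K : nat) : 'rV[R]_n :=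
  (weight_sum mu F K)^-1 *: \sum_(0 <= k < K.+1) weight mu F k *: x k.

Definition bound_strongly_convex (R : realType)
    (L mu bmax bt bh R0 eps : R) : R :=
  (L / mu + (1 - bh) / (1 - bmax) ^+ 2
     + L * Num.sqrt (bt * (1 - bh)) / (mu * (1 - bt) * Num.sqrt (1 - bmax)))
  * ln (R0 ^+ 2 / eps
        * (L + (1 - bh) / (1 - bmax) ^+ 2
           + L * Num.sqrt (bt * (1 - bh)) / ((1 - bt) * Num.sqrt (1 - bmax)))).

Definition bound_convex (R : realType) (L bmax bt bh R0 eps : R) : R :=
  L * R0 ^+ 2 / eps
  + L * R0 ^+ 2 * Num.sqrt (bt * (1 - bh))
      / (eps * (1 - bt) * Num.sqrt (1 - bmax)).

(* Main.v *)
Require Import Defs.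
From mathcomp Require Import all_boot all_order all_algebra.
From mathcomp Require Import all_classical all_reals all_analysis.
From mathcomp Require Import ring lra.

Import Order.TTheory GRing.Theory Num.Theory.
Import numFieldNormedType.Exports.
Local Open Scope ring_scope.

(* The virtual iterates z_k = x_k - (gamma/m) sum_i beta_i/(1-beta_i) V_{k-1}^(i)
   follow the inexact gradient step z_{k+1} = z_k - F grad f(x_k).  The lag
   |x_k - z_k|^2 is controlled by adding to |z_k - xs|^2 a multiple of
   sum_i beta_i/(1-beta_i) |V_{k-1}^(i)|^2; the resulting Lyapunov function
   contracts by 1 - mu F/2 up to -F/6 (f(x_k) - f(xs)), whence
   F W_K (f(xbar_K) - f(xs)) <= 6 R_0^2.

   The second ingredient is the energy bound f(x_k) <= f(x_0), obtained from the
   kinetic term (gamma/2m) sum_i beta_i |V_{k-1}^(i)|^2.  It settles the case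
   where the argument of the logarithm is at most 4/3.  In the other case the
   geometric growth of W_K gives (2/mu)(Z^6 - 1) <= F W_K for that argument Z,
   so that only mu R_0^2 <= L R_0^2 <= eps Z enters; in particular the term
   (1-bh)/(1-bmax)^2 inside the logarithm, which lacks the factor mu that
   1/F has, does no harm. *)

(** * Inner product and quadratic inequalities *)

Section InnerProduct.
Context {R : realType} {n : nat}.
Implicit Types u v w : 'rV[R]_n.

Lemma dotpC u v : dotp u v = dotp v u.
Proof. by apply: eq_bigr => j _; rewrite mulrC. Qed.

Lemma dotpDl u v w : dotp (u + v) w = dotp u w + dotp v w.
Proof. by rewrite /dotp -big_split; apply: eq_bigr => j _; rewrite mxE mulrDl. Qed.

Lemma dotpZl (a : R) u w : dotp (a *: u) w = a * dotp u w.
Proof. by rewrite /dotp mulr_sumr; apply: eq_bigr => j _; rewrite mxE mulrA. Qed.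

Lemma dotpNl u w : dotp (- u) w = - dotp u w.
Proof. by rewrite -scaleN1r dotpZl mulN1r. Qed.

Lemma dotp0l w : dotp 0 w = 0.
Proof. by rewrite -(scale0r w) dotpZl mul0r. Qed.

Lemma dotpDr u v w : dotp w (u + v) = dotp w u + dotp w v.
Proof. by rewrite dotpC dotpDl !(dotpC w). Qed.

Lemma dotpZr (a : R) u w : dotp w (a *: u) = a * dotp w u.
Proof. by rewrite dotpC dotpZl (dotpC w). Qed.

Lemma dotpNr u w : dotp w (- u) = - dotp w u.
Proof. by rewrite dotpC dotpNl (dotpC w). Qed.

Definition dotpE := (dotpDl, dotpDr, dotpNl, dotpNr, dotpZl, dotpZr).

Lemma dotp_sumr (I : Type) (r : seq I) (F : I -> 'rV[R]_n) w :
  dotp w (\sum_(i <- r) F i) = \sum_(i <- r) dotp w (F i).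
Proof.
elim/big_rec2: _ => [|i y1 y2 _ <-]; first by rewrite dotpC dotp0l.
exact: dotpDr.
Qed.

Lemma dotp_ge0 u : 0 <= dotp u u.
Proof. by apply: sumr_ge0 => j _; rewrite -expr2 sqr_ge0. Qed.

Lemma norm2_sqr u : norm2 u ^+ 2 = dotp u u.
Proof. exact: sqr_sqrtr (dotp_ge0 u). Qed.

Lemma dotp_young (t : R) u v :
  0 < t -> 2 * dotp u v <= t * dotp u u + t^-1 * dotp v v.
Proof.
move=> t0; have := dotp_ge0 (t *: u - v); rewrite !dotpE (dotpC v u) => H.
have -> : t * dotp u u + t^-1 * dotp v v =
    t^-1 * (t * (t * dotp u u) + dotp v v) by field; lra.
by rewrite ler_pdivlMl //; lra.
Qed.

(* Expand the nonnegative double sum of [p i * p j * |u i - u j|^2]. *)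
Lemma dotp_jensen (m : nat) (p : 'I_m -> R) (u : 'I_m -> 'rV[R]_n) :
  (forall i, 0 <= p i) ->
  dotp (\sum_i p i *: u i) (\sum_i p i *: u i)
    <= (\sum_i p i) * \sum_i p i * dotp (u i) (u i).
Proof.
move=> p0; set s := \sum_i p i *: u i; set P := \sum_i p i.
set Q := \sum_i p i * dotp (u i) (u i).
have ds w : dotp w s = \sum_i p i * dotp w (u i).
  by rewrite dotp_sumr; apply: eq_bigr => i _; rewrite dotpZr.
have inner i : \sum_j p j * dotp (u i - u j) (u i - u j) =
    P * dotp (u i) (u i) - 2 * dotp (u i) s + Q.
  rewrite ds mulr_suml mulr_sumr -sumrB -big_split /=.
  by apply: eq_bigr => j _; rewrite !dotpE (dotpC (u j)); ring.
have : 0 <= \sum_i p i * \sum_j p j * dotp (u i - u j) (u i - u j).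
  by apply: sumr_ge0 => i _; apply: mulr_ge0 => //; apply: sumr_ge0 => j _;
    apply: mulr_ge0 => //; apply: dotp_ge0.
under eq_bigr => i _ do rewrite inner.
have -> : \sum_i p i * (P * dotp (u i) (u i) - 2 * dotp (u i) s + Q) =
    P * Q - 2 * dotp s s + P * Q.
  rewrite [X in _ = X - _ + _](_ : P * Q = \sum_i P * (p i * dotp (u i) (u i))).
    rewrite [X in _ - X + _](_ : _ = \sum_i 2 * (p i * dotp s (u i))).
      rewrite -sumrB mulr_suml -big_split /=.
      by apply: eq_bigr => i _; rewrite (dotpC s); ring.
    by rewrite ds mulr_sumr.
  by rewrite mulr_sumr.
lra.
Qed.

End InnerProduct.

(** * First-order inequalities for smooth convex functions *)

Section SmoothConvex.
Context {R : realType} {n : nat} {f : 'rV[R]_n -> R} {L mu : R}.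
Hypotheses (L_gt0 : 0 < L) (mu_ge0 : 0 <= mu).
Hypotheses (fL : smooth L f) (fmu : strongly_convex mu f).

Lemma grad_ineq x y :
  f x + dotp (grad f x) (y - x) + mu / 2 * dotp (y - x) (y - x) <= f y.
Proof. by rewrite -norm2_sqr; exact: fmu.2. Qed.

Lemma grad_ineq0 x y : f x + dotp (grad f x) (y - x) <= f y.
Proof.
have := grad_ineq x y; have := mulr_ge0 mu_ge0 (dotp_ge0 (y - x)); lra.
Qed.

Lemma grad_lip x y :
  dotp (grad f x - grad f y) (grad f x - grad f y)
    <= L ^+ 2 * dotp (x - y) (x - y).
Proof.
rewrite -!norm2_sqr -exprMn ler_sqr ?nnegrE ?sqrtr_ge0 ?fL.2 //.
by rewrite mulr_ge0 ?sqrtr_ge0 ?ltW.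
Qed.

(** Young's inequality with weight [1/L] stands in for Cauchy-Schwarz: each of its two terms is then
    at most [L |x - y|^2]. *)
Lemma grad_lip_dotp x y :
  dotp (grad f x - grad f y) (x - y) <= L * dotp (x - y) (x - y).
Proof.
have Li : 0 < L^-1 by rewrite invr_gt0.
have := dotp_young _ (grad f x - grad f y) (x - y) Li.
have := ler_wpM2l (ltW Li) (grad_lip x y).
have -> : L^-1 * (L ^+ 2 * dotp (x - y) (x - y)) = L * dotp (x - y) (x - y).
  by field; rewrite gt_eqF.
rewrite invrK; lra.
Qed.

(* Two convexity inequalities through the midpoint avoid integrating the
   gradient, at the price of 3/4 instead of the optimal 1/2. *)
Lemma descent x y :
  f y <= f x + dotp (grad f x) (y - x) + 3 / 4 * L * dotp (y - x) (y - x).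
Proof.
set z := 2^-1 *: (x + y); set d := y - x.
have zx : z - x = 2^-1 *: d by apply/rowP => j; rewrite !mxE; field.
have xz : x - z = - (2^-1 *: d) by apply/rowP => j; rewrite !mxE; field.
have zy : z - y = - (2^-1 *: d) by apply/rowP => j; rewrite !mxE; field.
have := grad_ineq0 z x; have := grad_ineq0 y z.
have := grad_lip_dotp y x; have := grad_lip_dotp z x.
rewrite zx xz zy -/d; clearbody d.
move: (grad f x) (grad f y) (grad f z) => gx gy gz.
rewrite !dotpE.
move: (dotp d d) (dotp _ d) (dotp _ d) (dotp _ d) => D a b c.
lra.
Qed.

Context {xs : 'rV[R]_n} (xs_min : is_minimizer f xs).

(** A gradient step of length [t = 2 / (3 L)], the minimizer of the upper bound in [descent], lowers
    [f] by at least [t/2 |grad f x|^2], yet cannot go below [f xs]. *)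
Lemma grad_sqr_le x : dotp (grad f x) (grad f x) <= 3 * L * (f x - f xs).
Proof.
set t := 2 / (3 * L).
have tL : L * t = 2 / 3 by rewrite /t; field; rewrite gt_eqF.
have := descent x (x - t *: grad f x); have := xs_min (x - t *: grad f x).
move: (grad f x) => g; rewrite [x - _]addrC addrK; rewrite !dotpE => h1 h2.
have h3 : t * dotp g g / 2 <= f x - f xs.
  have -> : t * dotp g g / 2 =
    t * dotp g g
      - 3 / 4 * (L * t) * t * dotp g g by rewrite tL; field.
  lra.
have -> : dotp g g =
    3 * L * (t * dotp g g / 2) by rewrite /t; field; rewrite gt_eqF.
by rewrite ler_pM2l ?mulr_gt0.
Qed.

Lemma gap_le x : f x - f xs <= 3 / 4 * L * dotp (x - xs) (x - xs).
Proof.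
have g0 : dotp (grad f xs) (grad f xs) = 0.
  by apply/eqP; rewrite eq_le dotp_ge0; have := grad_sqr_le xs;
    rewrite subrr mulr0 => ->.
(* The gradient at [xs] has norm zero, so only the second Young term survives; the weight
   [(d + 1) / e] makes it [e d / (d + 1) <= e]. *)
have gl (e : R) : 0 < e -> 2 * dotp (grad f xs) (x - xs) <= e.
  move=> e0; set d := dotp (x - xs) (x - xs).
  have d0 : 0 <= d := dotp_ge0 _.
  have t0 : 0 < (d + 1) / e by rewrite divr_gt0 //; lra.
  have := dotp_young _ (grad f xs) (x - xs) t0; rewrite g0 mulr0 add0r -/d.
  move=> /le_trans; apply; rewrite invf_div mulrC mulrA ler_pdivrMr; last lra.
  by rewrite mulrC; rewrite ler_pM2l //; lra.
have := descent xs x.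
suff : 2 * dotp (grad f xs) (x - xs) <= 0 by lra.
by apply/ler_addgt0Pr => e /gl; rewrite add0r.
Qed.

(** Jensen's inequality from the tangent plane at the weighted average [z]: the weighted linear
    terms add up to zero. *)
Lemma gap_convex_comb (w : nat -> R) (y : nat -> 'rV[R]_n) (K : nat) :
  (forall k, 0 <= w k) -> 0 < \sum_(0 <= k < K) w k ->
  (\sum_(0 <= k < K) w k) *
    (f ((\sum_(0 <= k < K) w k)^-1 *: \sum_(0 <= k < K) w k *: y k) - f xs)
  <= \sum_(0 <= k < K) w k * (f (y k) - f xs).
Proof.
move=> w0; set W := \sum_(0 <= k < K) w k => W0; set s := \sum_(_ <= k < _) _ *: _.
set z := W^-1 *: s.
have sz : s = W *: z by rewrite scalerA divff ?scale1r //; lra.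
have e1 : \sum_(0 <= k < K) w k * dotp (grad f z) (y k - z) = 0.
  have -> : \sum_(0 <= k < K) w k * dotp (grad f z) (y k - z) =
      dotp (grad f z) s - W * dotp (grad f z) z.
    rewrite dotp_sumr mulr_suml -sumrB.
    by apply: eq_bigr => k _; rewrite !dotpE; ring.
  by rewrite sz dotpZr subrr.
have -> : W * (f z - f xs) =
  \sum_(0 <= k < K) w k * (f z + dotp (grad f z) (y k - z) - f xs).
  have -> : \sum_(0 <= k < K) w k * (f z + dotp (grad f z) (y k - z) - f xs) =
     W * (f z - f xs) + \sum_(0 <= k < K) w k * dotp (grad f z) (y k - z).
    rewrite mulr_suml -big_split /=; apply: eq_bigr => k _; ring.
  by rewrite e1 addr0.
apply: ler_sum => k _; apply: ler_wpM2l => //.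
by have := grad_ineq0 z (y k); lra.
Qed.

End SmoothConvex.

(** * The constants [L] and [mu] in positive dimension *)

Lemma smooth_ge0 {R : realType} {n : nat} {f : 'rV[R]_n.+1 -> R} {L : R} :
  smooth L f -> 0 <= L.
Proof.
move=> fL; set e : 'rV[R]_n.+1 := delta_mx 0 0.
have e0 : 0 < norm2 (e - 0).
  rewrite /norm2 sqrtr_gt0 subr0 /dotp (bigD1 ord0) //= !mxE !eqxx mulr1.
  by rewrite ltr_pwDl // sumr_ge0 // => j _; rewrite -expr2 sqr_ge0.
have := le_trans (sqrtr_ge0 _) (fL.2 e 0).
by rewrite pmulr_lge0.
Qed.

(** Adding the strong convexity inequalities between [0] and a unit vector [e] gives
    [mu |e|^2 <= <g1 - g0, e>]. With [|g1 - g0 - mu e|^2 >= 0] this yields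
    [mu^2 |e|^2 <= |g1 - g0|^2]. *)
Lemma strongly_convex_le_smooth {R : realType} {n : nat}
    {f : 'rV[R]_n.+1 -> R} {L mu : R} :
  smooth L f -> 0 <= mu -> strongly_convex mu f -> mu <= L.
Proof.
move=> fL mu0 fmu; have L0 := smooth_ge0 fL.
set e : 'rV[R]_n.+1 := delta_mx 0 0.
have e0 : 0 < dotp e e.
  rewrite /dotp (bigD1 ord0) //= !mxE !eqxx mulr1.
  by rewrite ltr_pwDl // sumr_ge0 // => j _; rewrite -expr2 sqr_ge0.
have := fL.2 e 0; rewrite -ler_sqr ?nnegrE ?mulr_ge0 ?sqrtr_ge0 //.
rewrite exprMn !norm2_sqr => h1.
have := grad_ineq fmu e 0; have := grad_ineq fmu 0 e.
move: h1; move: (grad f e) (grad f 0) => g1 g0.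
rewrite subr0 sub0r.
have := dotp_ge0 (g1 - g0 - mu *: e).
rewrite !dotpE !(dotpC e) !(dotpC g0 g1).
move: (dotp e e) e0 => N N0 h1 h2 h3 h4.
have : mu * (mu * N) <= mu * (dotp g1 e - dotp g0 e).
  by apply: ler_wpM2l => //; lra.
move=> h5.
have : mu ^+ 2 * N <= L ^+ 2 * N by lra.
by rewrite ler_pM2r // ler_sqr.
Qed.

(** * The AggHB recursion and its energy *)

Lemma aggHB_shift {R : realType} {n m : nat} {f : 'rV[R]_n -> R} {gamma : R}
    {beta : 'I_m -> R} {x0 : 'rV[R]_n} {x : nat -> 'rV[R]_n} :
  is_AggHB f (fun=> gamma) beta x0 x ->
  exists V : 'I_m -> nat -> 'rV[R]_n,
    [/\ x 0%N = x0, forall i, V i 0%N = 0,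
        forall i k, V i k.+1 = beta i *: V i k + grad f (x k) &
        forall k, x k.+1 = x k - gamma *: \sum_i m%:R^-1 *: V i k.+1].
Proof.
case=> V [x0E V0 VS xS].
(* Index shift: the new [V i k] is the momentum of step [k - 1], so that [V i 0 = 0] encodes the
   initial condition. *)
exists (fun i k => if k is k'.+1 then V i k' else 0); split.
- exact: x0E.
- by [].
- by move=> i [|k]; [rewrite V0 | rewrite VS].
move=> k; rewrite xS; congr (_ - _).
rewrite scaler_sumr scaler_sumr; apply: eq_bigr => i _.
by rewrite !scalerA mulrC.
Qed.

Section AggHB.
(** The values to be substituted are [c = 1/m], [H = 1 / (1 - bh)] and [S = bt / (1 - bt)^2]. *)
Context {R : realType} {n m : nat} {f : 'rV[R]_n -> R} {L mu gamma c H S : R}.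
Context {beta : 'I_m -> R} {xs : 'rV[R]_n} {x : nat -> 'rV[R]_n}.
Context {V : 'I_m -> nat -> 'rV[R]_n}.
Hypotheses (L_gt0 : 0 < L) (mu_ge0 : 0 <= mu) (gamma_gt0 : 0 < gamma).
Hypothesis c_ge0 : 0 <= c.
Hypotheses (fL : smooth L f) (fmu : strongly_convex mu f).
Hypothesis xs_min : is_minimizer f xs.
Hypothesis beta01 : forall i, 0 <= beta i < 1.
Hypothesis V0 : forall i, V i 0%N = 0.
Hypothesis VS : forall i k, V i k.+1 = beta i *: V i k + grad f (x k).
Hypothesis xS : forall k, x k.+1 = x k - gamma *: \sum_i c *: V i k.+1.
Hypothesis HE : \sum_i c / (1 - beta i) = H.
Hypothesis SE : \sum_i c * (beta i / (1 - beta i) ^+ 2) = S.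
Hypothesis gamma_H : 4 * L * gamma * H <= 1.

Local Notation g k := (grad f (x k)).

Let bne i : 1 - beta i != 0.
Proof. by have /andP[_ h] := beta01 i; rewrite gt_eqF // subr_gt0. Qed.
Let bgt0 i : 0 < 1 - beta i.
Proof. by have /andP[_ h] := beta01 i; rewrite subr_gt0. Qed.
Let bge0 i : 0 <= beta i.
Proof. by have /andP[] := beta01 i. Qed.

(** With [g k = V i k.+1 - beta i *: V i k], the cross term is bounded through
    [|V i k.+1 - V i k|^2 >= 0]. What remains is the increment of kinetic energy plus the
    dissipation [(1 - beta i) |V i k.+1|^2]. *)
Lemma momentum_energy i k :
  dotp (V i k.+1) (V i k.+1) / 2 * beta i
    + (1 - beta i) * dotp (V i k.+1) (V i k.+1)
    - dotp (V i k) (V i k) / 2 * beta i <= dotp (g k) (V i k.+1).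
Proof.
have -> : g k = V i k.+1 - beta i *: V i k by rewrite VS addrAC subrr add0r.
move: (V i k.+1) (V i k) => w v.
have := mulr_ge0 (bge0 i) (dotp_ge0 (w - v)).
rewrite !dotpE (dotpC w v); lra.
Qed.

(** The total dissipation [B] absorbs the quadratic term of [descent]: Jensen with weights
    [c / (1 - beta i)], of sum [H], gives [|w|^2 <= H B], and [4 L gamma H <= 1]. *)
Lemma energy_decrease k :
  f (x k.+1) + gamma / 2 * \sum_i c * (beta i * dotp (V i k.+1) (V i k.+1))
  <= f (x k) + gamma / 2 * \sum_i c * (beta i * dotp (V i k) (V i k)).
Proof.
set w := \sum_i c *: V i k.+1.
set A' := \sum_i _ * (_ * dotp (V _ k.+1) _).
set A := \sum_i _ * (_ * dotp (V _ k) _).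
pose B := \sum_i c * ((1 - beta i) * dotp (V i k.+1) (V i k.+1)).
have B0 : 0 <= B.
  by apply: sumr_ge0 => i _; rewrite !mulr_ge0 ?dotp_ge0 // ltW.
have gw : A' / 2 + B - A / 2 <= dotp (g k) w.
  rewrite /w dotp_sumr /A /A' /B !mulr_suml -big_split -sumrB /=.
  apply: ler_sum => i _; rewrite dotpZr.
  have := ler_wpM2l c_ge0 (momentum_energy i k); lra.
have wB : dotp w w <= H * B.
  have -> : w = \sum_i (c / (1 - beta i)) *: ((1 - beta i) *: V i k.+1).
    by apply: eq_bigr => i _; rewrite scalerA divfK.
  have -> : B = \sum_i (c / (1 - beta i)) *
       dotp ((1 - beta i) *: V i k.+1) ((1 - beta i) *: V i k.+1).
    by apply: eq_bigr => i _; rewrite dotpZl dotpZr; field.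
  rewrite -HE; apply: dotp_jensen => i.
  by rewrite divr_ge0 // ltW.
have xB : x k.+1 - x k = - (gamma *: w) by rewrite xS addrAC subrr add0r.
have := descent L_gt0 mu_ge0 fL fmu (x k) (x k.+1).
rewrite xB !dotpNr dotpNl !dotpZr dotpZl => h.
have h1 : L * gamma * dotp w w <= B / 4.
  apply: (@le_trans _ _ (L * gamma * (H * B))).
    by apply: ler_wpM2l => //; rewrite mulr_ge0 // ltW.
  have -> : L * gamma * (H * B) = 4 * L * gamma * H * (B / 4) by field.
  by rewrite ler_piMl // divr_ge0.
have h2 := ler_wpM2l (ltW gamma_gt0) h1.
have h3 := ler_wpM2l (ltW gamma_gt0) gw.
have h4 := mulr_ge0 (ltW gamma_gt0) B0.
lra.
Qed.

Lemma iterates_gap_le k : f (x k) <= f (x 0%N).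
Proof.
pose E k := f (x k) + gamma / 2 * \sum_i c * (beta i * dotp (V i k) (V i k)).
have E0 : E 0%N = f (x 0%N).
  by rewrite /E big1 ?mulr0 ?addr0 // => i _; rewrite V0 dotp0l !mulr0.
have : E k <= E 0%N.
  elim: k => // k; apply: le_trans; exact: energy_decrease.
rewrite E0; apply: le_trans; rewrite lerDl mulr_ge0 // ?divr_ge0 ?(ltW gamma_gt0) //.
by apply: sumr_ge0 => i _; rewrite !mulr_ge0 ?dotp_ge0.
Qed.

(** * Virtual iterates and their lag *)

Definition virtual_iterate k :=
  x k - gamma *: \sum_i (c * (beta i / (1 - beta i))) *: V i k.

(** Since [1 + b / (1 - b) = 1 / (1 - b)], step and new correction combine to [V i k.+1 / (1 - b)].
    Its part [b V i k / (1 - b)] is the old correction, which leaves [g k / (1 - b)]. *)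
Lemma virtual_iterateS k :
  virtual_iterate k.+1 = virtual_iterate k - (gamma * H) *: g k.
Proof.
rewrite /virtual_iterate xS -!addrA -!opprD -scalerA -!scalerDr.
congr (_ - _ *: _); rewrite -HE scaler_suml -!big_split /=.
apply: eq_bigr => i _; rewrite -scalerDl VS !scalerDr !scalerA.
by congr (_ *: _ + _ *: _); field.
Qed.

(** Jensen for the vectors [(1 - beta i) *: V i k] with weights of sum [S]. This splitting leaves
    exactly the sum that [momentum_potential] dissipates. *)
Lemma virtual_lag_le k :
  dotp (x k - virtual_iterate k) (x k - virtual_iterate k)
  <= gamma ^+ 2 * (S * \sum_i c * (beta i * dotp (V i k) (V i k))).
Proof.
have -> : x k - virtual_iterate k =
    gamma *: \sum_i (c * (beta i / (1 - beta i) ^+ 2)) *: ((1 - beta i) *: V i k).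
  rewrite /virtual_iterate opprB addrC subrK; congr (_ *: _).
  by apply: eq_bigr => i _; rewrite scalerA; congr (_ *: _); field.
rewrite dotpZl dotpZr mulrA -expr2 ler_wpM2l ?sqr_ge0 //.
have -> : \sum_i c * (beta i * dotp (V i k) (V i k)) =
    \sum_i (c * (beta i / (1 - beta i) ^+ 2)) *
      dotp ((1 - beta i) *: V i k) ((1 - beta i) *: V i k).
  by apply: eq_bigr => i _; rewrite dotpZl dotpZr; field.
rewrite -SE; apply: dotp_jensen => i.
by rewrite mulr_ge0 ?divr_ge0 ?exprn_ge0 // ltW.
Qed.

(** * Momentum potential and Lyapunov function *)

Local Notation q := (1 - mu * (gamma * H) / 2).
(** Squared momenta decay at rate [beta i]; this margin below the target rate [q] is what pays for
    the lag. *)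
Hypothesis q_beta : forall i, 3 / 4 * (1 - beta i) <= q - beta i.

(** Convexity of the squared norm: [V i k.+1] is the combination of [V i k] and [g k / (1 - beta i)]
    with weights [beta i] and [1 - beta i]. *)
Lemma momentum_sqr_le i k :
  dotp (V i k.+1) (V i k.+1)
  <= beta i * dotp (V i k) (V i k) + dotp (g k) (g k) / (1 - beta i).
Proof.
rewrite VS; move: (V i k) (g k) => v w.
have := ler_wpM2l (bge0 i) (dotp_young (1 - beta i) v w (bgt0 i)).
have -> : dotp w w / (1 - beta i) =
    dotp w w + beta i * ((1 - beta i)^-1 * dotp w w) by field.
rewrite !dotpE (dotpC w v); lra.
Qed.

(** The coefficient [beta i / (1 - beta i)] turns the margin [q_beta] into [3/4 beta i |V i k|^2];
    the factor [4/3] normalizes this release to 1. *)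
Lemma momentum_potential k :
  \sum_i c * (beta i * dotp (V i k) (V i k))
    + 4 / 3 * \sum_i c * (beta i / (1 - beta i) * dotp (V i k.+1) (V i k.+1))
  <= q * (4 / 3 * \sum_i c * (beta i / (1 - beta i) * dotp (V i k) (V i k)))
    + 4 / 3 * (S * dotp (g k) (g k)).
Proof.
rewrite -SE mulr_suml !mulr_sumr -!big_split /=.
apply: ler_sum => i _.
set U' := dotp (V i k.+1) _; set U := dotp (V i k) _; set G := dotp (g k) _.
have U0 : 0 <= U := dotp_ge0 _.
have b2 : 0 <= beta i / (1 - beta i) by rewrite divr_ge0 // ltW.
have h1 : U' <= beta i * U + G / (1 - beta i) := momentum_sqr_le i k.
have := ler_wpM2l c_ge0 (ler_wpM2l b2 h1).
have := ler_wpM2l c_ge0 (ler_wpM2l (mulr_ge0 b2 U0) (q_beta i)).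
have -> : beta i / (1 - beta i) * U * (3 / 4 * (1 - beta i)) =
    3 / 4 * (beta i * U) by field.
have -> : c * (beta i / (1 - beta i) * (beta i * U + G / (1 - beta i))) =
    c * (beta i / (1 - beta i) * U * beta i)
    + c * (beta i / (1 - beta i) ^+ 2) * G by field.
lra.
Qed.

Hypothesis mu_L : mu <= L.
Hypothesis H_ge0 : 0 <= H.
Hypothesis gamma_S : 48 * (L * gamma * S) ^+ 2 <= 1.

Local Notation F := (gamma * H).

(** The coefficient is that of the lag [7 L F |x_k - z_k|^2] after [virtual_lag_le], so the release
    of the potential cancels it. *)
Definition lyapunov k :=
  dotp (virtual_iterate k - xs) (virtual_iterate k - xs)
  + 7 * L * F * gamma ^+ 2 * S
    * (4 / 3 * \sum_i c * (beta i / (1 - beta i) * dotp (V i k) (V i k))).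

(** Coefficients of [F h]: [-2] from strong convexity, [1/2] from Young, [3/4] from [F^2 |g k|^2].
    The lag costs [6 L F] from Young and [mu F <= L F] from replacing [x k] by the virtual iterate
    in the contraction. *)
Lemma virtual_contraction k :
  dotp (virtual_iterate k.+1 - xs) (virtual_iterate k.+1 - xs)
  <= q * dotp (virtual_iterate k - xs) (virtual_iterate k - xs)
     - 3 / 4 * F * (f (x k) - f xs)
     + 7 * L * F * dotp (x k - virtual_iterate k) (x k - virtual_iterate k).
Proof.
have F0 : 0 <= F by rewrite mulr_ge0 // ltW.
set h := f (x k) - f xs; set d := x k - virtual_iterate k.
have tx : virtual_iterate k - xs = (x k - xs) - d 
  by rewrite /d opprB [RHS]addrC addrA subrK.
rewrite virtual_iterateS addrAC tx.
have := grad_ineq fmu (x k) xs.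
have := grad_sqr_le L_gt0 mu_ge0 fL fmu xs_min (x k).
have L6 : 0 < (6 * L)^-1 by rewrite invr_gt0 mulr_gt0.
have := dotp_young (6 * L)^-1 (g k) d L6; rewrite invrK.
have -> : xs - x k = - (x k - xs) by rewrite opprB.
clearbody d; move: (x k - xs) (g k) => y w.
rewrite dotpNr dotpNl dotpNr opprK => yg gs cv.
have gs' : (6 * L)^-1 * dotp w w <= h / 2.
  by rewrite ler_pdivrMl ?mulr_gt0 // /h; lra.
have Fg : F ^+ 2 * dotp w w <= 3 / 4 * (F * h).
  apply: (@le_trans _ _ (F ^+ 2 * (3 * L * h))).
    by apply: ler_wpM2l gs; rewrite sqr_ge0.
  have -> : F ^+ 2 * (3 * L * h) = 4 * L * gamma * H * (3 / 4 * (F * h)) by field.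
  rewrite ler_piMl // mulr_ge0 // mulr_ge0 //.
  by rewrite /h subr_ge0.
have yd : dotp (y - d) (y - d) <= 2 * dotp y y + 2 * dotp d d.
  by have := dotp_ge0 (y + d); rewrite !dotpE (dotpC d y); lra.
have muyd := ler_wpM2l (mulr_ge0 mu_ge0 F0) yd.
have muL := ler_wpM2r (mulr_ge0 F0 (dotp_ge0 d)) mu_L.
have cv' : 2 * F * (h + mu / 2 * dotp y y) <= 2 * F * dotp w y.
  by apply: ler_wpM2l; [rewrite mulr_ge0 | rewrite /h; lra].
have yg' := ler_wpM2l F0 (le_trans yg (lerD gs' (lexx _))).
have -> : dotp (y - d - F *: w) (y - d - F *: w) =
   dotp (y - d) (y - d) - 2 * F * dotp w y + 2 * F * dotp w d + F ^+ 2 * dotp w w.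
  by rewrite !dotpE (dotpC y w) (dotpC d w); ring.
move: (dotp (y - d) (y - d)) muyd => N muyd.
rewrite -/h in gs *; clearbody h.
lra.
Qed.

(** The gradient term left by the potential is at most [28 (L gamma S)^2 F h <= 28/48 F h], and
    [-3/4 + 28/48 = -1/6]. *)
Lemma lyapunov_decrease k :
  lyapunov k.+1 <= q * lyapunov k - F / 6 * (f (x k) - f xs).
Proof.
have F0 : 0 <= F by rewrite mulr_ge0 // ltW.
have S0 : 0 <= S.
  rewrite -SE; apply: sumr_ge0 => i _.
  by rewrite mulr_ge0 ?divr_ge0 ?exprn_ge0 // ltW.
have h0 : 0 <= f (x k) - f xs by rewrite subr_ge0.
rewrite /lyapunov.
have := virtual_contraction k.
have LF : 0 <= 7 * L * F by rewrite !mulr_ge0 // ltW.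
have a0 : 0 <= 7 * L * F * gamma ^+ 2 * S by rewrite !mulr_ge0 ?sqr_ge0 // ltW.
have := ler_wpM2l LF (virtual_lag_le k).
have := ler_wpM2l a0 (momentum_potential k).
have := grad_sqr_le L_gt0 mu_ge0 fL fmu xs_min (x k) => gs.
have a1 : 0 <= 7 * L * F * gamma ^+ 2 * S * (4 / 3 * S).
  by rewrite mulr_ge0 // mulr_ge0.
have := ler_wpM2l a1 gs.
have := ler_wpM2l (mulr_ge0 F0 h0) gamma_S.
move: (\sum_i _) (\sum_i _) (\sum_i _) => M1 M2 M3.
move: (dotp _ _) (dotp _ _) (dotp _ _) (dotp _ _) => d1 d2 d3 d4.
move: (f (x k) - f xs) => h.
lra.
Qed.

(** * Weighted averages of the iterates *)

Hypothesis q_gt0 : 0 < q.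

Lemma lyapunov_ge0 k : 0 <= lyapunov k.
Proof.
have S0 : 0 <= S.
  rewrite -SE; apply: sumr_ge0 => i _.
  by rewrite mulr_ge0 ?divr_ge0 ?exprn_ge0 // ltW.
rewrite addr_ge0 ?dotp_ge0 // mulr_ge0 //.
  by rewrite !mulr_ge0 ?sqr_ge0 // ltW.
rewrite mulr_ge0 // sumr_ge0 // => i _.
by rewrite mulr_ge0 // mulr_ge0 ?dotp_ge0 // divr_ge0 // ltW.
Qed.

(** Multiplied by [q ^- k.+1], which is the weight of step [k], [lyapunov_decrease] telescopes. The
    potential vanishes at step 0. *)
Lemma weighted_gap_sum K :
  F / 6 * (\sum_(0 <= k < K) weight mu F k * (f (x k) - f xs))
    + q ^- K * lyapunov K <= dotp (x 0%N - xs) (x 0%N - xs).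
Proof.
elim: K => [|K IH].
  rewrite big_nil mulr0 add0r expr0 invr1 mul1r /lyapunov /virtual_iterate.
  rewrite !big1 ?scaler0 ?subr0 ?mulr0 ?addr0 // => i _.
    by rewrite V0 dotp0l !mulr0.
  by rewrite V0 scaler0.
apply: le_trans IH; rewrite big_nat_recr //= mulrDr -addrA lerD2l.
have qK : 0 <= q ^- K.+1 by rewrite invr_ge0 exprn_ge0 // ltW.
have := ler_wpM2l qK (lyapunov_decrease K).
have -> : q ^- K = q ^- K.+1 * q.
  by rewrite exprS invfM [RHS]mulrAC mulVf ?mul1r // gt_eqF.
rewrite /weight; lra.
Qed.

Let w_ge0 k : 0 <= weight mu F k.
Proof. by rewrite invr_ge0 exprn_ge0 // ltW. Qed.

Let W_gt0 K : 0 < \sum_(0 <= k < K.+1) weight mu F k.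
Proof.
rewrite big_nat_recr //= ltr_wpDl ?sumr_ge0 //.
by rewrite invr_gt0 exprn_gt0.
Qed.

Lemma weighted_avg_gap K :
  F * (weight_sum mu F K * (f (weighted_avg mu F x K) - f xs))
  <= 6 * dotp (x 0%N - xs) (x 0%N - xs).
Proof.
have F0 : 0 <= F by rewrite mulr_ge0 // ltW.
have h1 := gap_convex_comb mu_ge0 fmu (xs := xs) (weight mu F) x K.+1 w_ge0 (W_gt0 K).
have h2 := weighted_gap_sum K.+1.
have h3 : 0 <= q ^- K.+1 * lyapunov K.+1.
  by rewrite mulr_ge0 ?lyapunov_ge0 // invr_ge0 exprn_ge0 // ltW.
have := ler_wpM2l F0 h1; rewrite -/(weight_sum mu F K) -/(weighted_avg mu F x K).
lra.
Qed.

(** A bound valid for every [K], including those too small for any contraction; it combines Jensen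
    with the energy bound. *)
Lemma weighted_avg_gap_le K :
  f (weighted_avg mu F x K) - f xs <= 3 / 4 * L * dotp (x 0%N - xs) (x 0%N - xs).
Proof.
apply: le_trans (gap_le L_gt0 mu_ge0 fL fmu xs_min (x 0%N)).
rewrite -(ler_pM2l (W_gt0 K)).
apply: (le_trans (gap_convex_comb mu_ge0 fmu (weight mu F) x K.+1 w_ge0 (W_gt0 K))).
rewrite mulr_suml; apply: ler_sum => k _; apply: ler_wpM2l => //.
rewrite lerD2r; exact: iterates_gap_le.
Qed.

End AggHB.

(** * Weight sums, exponentials and extended-real quotients *)

Lemma weight_sum_geometric (R : realType) (mu F : R) (K : nat) :
  1 - mu * F / 2 != 0 ->
  mu * F / 2 * weight_sum mu F K = (1 - mu * F / 2) ^- K.+1 - 1.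
Proof.
rewrite /weight_sum /weight; set q := 1 - _ => q0.
have -> : mu * F / 2 = 1 - q by rewrite /q; ring.
elim: K => [|K IH]; first by rewrite big_nat1 expr1; field.
rewrite big_nat_recr //= mulrDr IH.
have -> : q ^- K.+1 = q * q ^- K.+2.
  by rewrite [in RHS]exprS invfM mulrA divff ?mul1r.
by ring.
Qed.

Lemma weight_sum0 (R : realType) (F : R) (K : nat) :
  weight_sum 0 F K = K.+1%:R.
Proof.
rewrite /weight_sum /weight (eq_bigr (fun=> 1)); last first.
  by move=> k _; rewrite !mul0r subr0 expr1n invr1.
by rewrite sumr_const_nat subn0.
Qed.

Lemma expR_le_invX (R : realType) (a : R) (K : nat) :
  a < 1 -> expR (K%:R * a) <= (1 - a) ^- K.
Proof.
move=> a1; have q0 : 0 < 1 - a by rewrite subr_gt0.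
rewrite expRM_natl -exprVn.
apply: lerXn2r; rewrite ?nnegrE ?expR_ge0 ?invr_ge0 ?(ltW q0) //.
rewrite -(invrK (expR a)) -expRN lef_pV2 ?posrE ?expR_gt0 //.
exact: expR_ge1Dx.
Qed.

Lemma ereal_div_EFin (R : realType) (a b : R) :
  0 < a -> (a%:E / b%:E)%E = if b == 0 then +oo%E else (a / b)%:E.
Proof.
by move=> a0; rewrite inver; case: eqP => // _; rewrite mulry gtr0_sg // mul1e.
Qed.

(** The product form also covers [b = 0], where the quotient is [+oo] and the claim becomes
    [0 <= a]. *)
Lemma le_ereal_div (R : realType) (x a b : R) :
  0 < a -> 0 <= b -> (x%:E <= a%:E / b%:E)%E -> x * b <= a.
Proof.
move=> a0 b0; rewrite ereal_div_EFin //.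
case: eqP => [-> _|/eqP bn]; first by rewrite mulr0 ltW.
by rewrite lee_fin ler_pdivlMr // lt_neqAle eq_sym bn.
Qed.

Lemma eq_ereal_div (R : realType) (x a b : R) :
  0 < a -> x%:E = (a%:E / b%:E)%E -> b != 0 /\ x = a / b.
Proof.
by move=> a0; rewrite ereal_div_EFin //; case: eqP => // bn [->].
Qed.

(** * Upper and lower bounds on the stepsize *)

Section Stepsize.
Context {R : realType} {L mu bmax bt bh gamma : R}.
Hypotheses (L_gt0 : 0 < L) (mu_ge0 : 0 <= mu).
Hypotheses (bmax_lt1 : bmax < 1) (bt01 : 0 <= bt < 1) (bh_lt1 : bh < 1).
Hypothesis gammaE : gamma%:E = aggHB_stepsize L mu bmax bt bh.

Let bt0 : 0 <= bt. Proof. by case/andP: bt01. Qed.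
Let bmax1 : 0 < 1 - bmax. Proof. by rewrite subr_gt0. Qed.
Let bh1 : 0 < 1 - bh. Proof. by rewrite subr_gt0. Qed.
Let bt1 : 0 < 1 - bt. Proof. by case/andP: bt01 => _; rewrite subr_gt0. Qed.
Let sq_gt0 : 0 < Num.sqrt ((1 - bh) * (1 - bmax)).
Proof. by rewrite sqrtr_gt0 mulr_gt0. Qed.
Let sq3_gt0 : 0 < Num.sqrt 3 :> R.
Proof. by rewrite sqrtr_gt0. Qed.

Lemma stepsize_mu : 2 * mu * gamma <= (1 - bmax) ^+ 2.
Proof.
rewrite mulrC; apply: le_ereal_div; rewrite ?exprn_gt0 ?mulr_ge0 //.
by rewrite gammaE /aggHB_stepsize (@ge_min _ (\bar R)) lexx.
Qed.

Lemma stepsize_L : 4 * L * gamma <= 1 - bh.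
Proof.
rewrite mulrC; apply: le_ereal_div => //; first by rewrite mulr_ge0 ?ltW.
by rewrite gammaE /aggHB_stepsize !(@ge_min _ (\bar R)) lexx orbT.
Qed.

Lemma stepsize_bt :
  0 <= gamma ->
  48 * (L * gamma) ^+ 2 * bt <= (1 - bt) ^+ 2 * ((1 - bh) * (1 - bmax)).
Proof.
move=> g0.
have h : gamma * (4 * Num.sqrt 3 * L * Num.sqrt bt)
    <= (1 - bt) * Num.sqrt ((1 - bh) * (1 - bmax)).
  apply: le_ereal_div; [by rewrite mulr_gt0 | |].
    by rewrite !mulr_ge0 ?sqrtr_ge0 // ltW.
  by rewrite gammaE /aggHB_stepsize !(@ge_min _ (\bar R)) lexx !orbT.
have : (gamma * (4 * Num.sqrt 3 * L * Num.sqrt bt)) ^+ 2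
    <= ((1 - bt) * Num.sqrt ((1 - bh) * (1 - bmax))) ^+ 2.
  rewrite ler_sqr ?nnegrE //; first by rewrite !mulr_ge0 ?sqrtr_ge0 // ltW.
  by rewrite mulr_ge0 ?sqrtr_ge0 // ltW.
rewrite !exprMn (sqr_sqrtr bt0) !sqr_sqrtr ?(mulr_ge0 (ltW bh1) (ltW bmax1)) //.
lra.
Qed.

Local Notation X := ((1 - bh) / (1 - bmax) ^+ 2).
Local Notation Y :=
  (L * Num.sqrt (bt * (1 - bh)) / ((1 - bt) * Num.sqrt (1 - bmax))).

Let muX_ge0 : 0 <= mu * X.
Proof. by rewrite mulr_ge0 // divr_ge0 ?exprn_ge0 // ltW. Qed.

Let Y_ge0 : 0 <= Y.
Proof. by rewrite divr_ge0 // mulr_ge0 ?sqrtr_ge0 // ltW. Qed.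

(** The minimum equals one of its terms, which has a nonzero denominator because [gamma] is finite.
    Divided by [gamma], the claim bounds [1/F] from above. *)
Lemma stepsize_lower : 1 - bh <= 7 * gamma * (mu * X + L + Y).
Proof.
have bmn : 1 - bmax != 0 by rewrite gt_eqF.
have btn : 1 - bt != 0 by rewrite gt_eqF.
have Ln : L != 0 by rewrite gt_eqF.
(* Each case carries [0 <= gamma], because positivity of the stepsize is itself derived from this
   lemma. *)
suff : [\/ 0 <= gamma /\ 1 - bh <= 2 * gamma * (mu * X),
    0 <= gamma /\ 1 - bh <= 4 * gamma * L | 0 <= gamma /\ 1 - bh <= 7 * gamma * Y].
  by case=> -[g0 h]; have := mulr_ge0 g0 muX_ge0; have := mulr_ge0 g0 Y_ge0;
    have := mulr_ge0 g0 (ltW L_gt0); lra.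
move: gammaE; rewrite /aggHB_stepsize.
rewrite {1}/Order.min; case: ifP => _.
  move=> /eq_ereal_div[|d0 ->]; first by rewrite exprn_gt0.
  constructor 1; split.
    by rewrite divr_ge0 ?exprn_ge0 ?mulr_ge0 // ltW.
  rewrite le_eqVlt; apply/orP; left; apply/eqP; field.
  by move: d0; rewrite mulf_eq0 negb_or => /andP[_ ->]; rewrite bmn.
rewrite {1}/Order.min; case: ifP => _.
  move=> /eq_ereal_div[//|d0 ->].
  constructor 2; split.
    by rewrite divr_ge0 ?mulr_ge0 ?ltW.
  by rewrite le_eqVlt; apply/orP; left; apply/eqP; field.
move=> /eq_ereal_div[|d0 ->]; first by rewrite mulr_gt0.
constructor 3; split.
  by rewrite divr_ge0 ?mulr_ge0 ?sqrtr_ge0 ?ltW.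
have sbn : Num.sqrt bt != 0 by move: d0; rewrite mulf_eq0 negb_or => /andP[].
have smn : Num.sqrt (1 - bmax) != 0 by rewrite gt_eqF // sqrtr_gt0.
have s3n : Num.sqrt 3 != 0 :> R by rewrite gt_eqF.
(* This is [4 sqrt 3 <= 7], the source of the constant 7. *)
have s3 : Num.sqrt 3 <= 7 / 4 :> R.
  rewrite -ler_sqr ?nnegrE ?sqrtr_ge0 // sqr_sqrtr //; lra.
have -> : 7 * ((1 - bt) * Num.sqrt ((1 - bh) * (1 - bmax)) /
     (4 * Num.sqrt 3 * L * Num.sqrt bt)) * Y = (1 - bh) * (7 / 4 / Num.sqrt 3).
  rewrite -[in RHS](sqr_sqrtr (ltW bh1)) (sqrtrM _ (ltW bh1)) (sqrtrM _ bt0).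
  by field; rewrite s3n sbn smn Ln btn.
by rewrite (ler_peMr (ltW bh1)) // ler_pdivlMr // mul1r.
Qed.

Lemma stepsize_gt0 : 0 < gamma.
Proof.
have T0 : 0 < mu * X + L + Y by rewrite ltr_wpDr // ltr_wpDl.
have := lt_le_trans bh1 stepsize_lower.
by rewrite -mulrA pmulr_rgt0 // pmulr_lgt0.
Qed.

End Stepsize.

(** * From scalar estimates to iteration counts *)

(* The logarithm must not be used when [Z] is close to 1 or smaller: there
   the bound on [K] is void, and [delta <= 3 / 4 * L * r] takes over. *)
Lemma linear_rate (R : realType) (L mu F T Z r eps delta : R) (K : nat) :
  0 < mu -> mu <= L -> 0 < F -> mu * F / 2 < 1 -> 0 < eps -> 0 <= r ->
  0 <= delta -> delta <= 3 / 4 * L * r ->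
  F * (weight_sum mu F K * delta) <= 6 * r ->
  L * r <= eps * Z -> 1 <= 7 * F * T ->
  84 * (T / mu * ln Z) <= K%:R -> delta <= eps.
Proof.
move=> mu0 muL F0 a1 eps0 r0 d0 dLr Wd LrZ FT.
case: (lerP Z (4 / 3)) => [Z43 _|Z43 KZ].
  have := ler_wpM2l (ltW eps0) Z43; lra.
have Z0 : 0 < Z by lra.
have lnZ0 : 0 <= ln Z by rewrite ln_ge0 //; lra.
set a := mu * F / 2 in a1.
have a0 : 0 < a by rewrite /a divr_gt0 ?mulr_gt0.
(* Here [84 = 2 * 7 * 6]: the 2 cancels that of [a = mu F / 2], the 7 is spent on [FT], and 6
   remains as the exponent of [Z]. *)
have Ka : 6%:R * ln Z <= K.+1%:R * a.
  have h1 : a * (84 * (T / mu * ln Z)) <= a * K%:R.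
    by rewrite ler_wpM2l // ltW.
  have h2 : a * (84 * (T / mu * ln Z)) = 6 * (7 * F * T * ln Z).
    by rewrite /a; field; rewrite gt_eqF.
  have := ler_wpM2r lnZ0 FT.
  by rewrite -[K.+1]addn1 natrD; lra.
have Z6 : Z ^+ 6 <= (1 - a) ^- K.+1.
  apply: le_trans (expR_le_invX R a K.+1 a1).
  by rewrite -{1}(lnK Z0) -expRM_natl ler_expR.
(* The exponent 6 suffices because [(4/3)^5 > 4]; then [Z^6 - 1 >= 3 Z]. *)
have Z4 : 4 * Z <= Z ^+ 6.
  have : 4 <= Z ^+ 5.
    have : (4 / 3) ^+ 5 <= Z ^+ 5 by rewrite lerXn2r ?nnegrE //; lra.
    by apply: le_trans; lra.
  by move=> /(ler_wpM2r (ltW Z0)); rewrite -exprSr.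
have qn : 1 - mu * F / 2 != 0 by rewrite gt_eqF // subr_gt0.
have := weight_sum_geometric R mu F K qn; rewrite -/a => aW.
have h3 : 3 * Z * delta <= a * weight_sum mu F K * delta.
  by rewrite ler_wpM2r // aW; lra.
have h4 := ler_wpM2l (ltW mu0) Wd.
have h5 := ler_wpM2r r0 muL.
have h6 : Z * delta <= Z * eps by rewrite /a in h3; lra.
by rewrite ler_pM2l in h6.
Qed.

Lemma sublinear_rate (R : realType) (F T r eps delta : R) (K : nat) :
  0 < F -> 0 < eps -> 0 <= r ->
  F * (K.+1%:R * delta) <= 6 * r -> 1 <= 7 * F * T ->
  84 * (r / eps * T) <= K%:R -> delta <= eps.
Proof.
move=> F0 eps0 r0 Kd FT KT; rewrite leNgt; apply/negP => de.
have h1 : F * (K.+1%:R * eps) <= F * (K.+1%:R * delta).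
  by rewrite ler_wpM2l ?ler_wpM2l // ltW.
have Fe : 0 < F * eps by rewrite mulr_gt0.
have h2 := ler_wpM2l (ltW Fe) KT.
have h3 := ler_wpM2r r0 FT.
have h4 : F * eps * (84 * (r / eps * T)) = 12 * (7 * F * T * r).
  by field; rewrite gt_eqF.
(* The hypotheses give [12 r + F eps <= 6 r]; the summand [F eps], due to [K + 1] in place of [K],
   makes this absurd even for [r = 0]. *)
rewrite -[K.+1]addn1 natrD in h1 Kd; lra.
Qed.

(** * Verification of the hypotheses and conclusion *)

Lemma beta_max_ge {R : realType} {m : nat} (beta : 'I_m -> R) i :
  beta i <= beta_max beta.
Proof. exact: le_bigmax. Qed.

Lemma beta_max_lt1 {R : realType} {m : nat} (beta : 'I_m -> R) :
  (forall i, 0 <= beta i < 1) -> beta_max beta < 1.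
Proof. by move=> b; apply: bigmax_lt => // i _; case/andP: (b i). Qed.

Theorem corollary2p6 (R : realType) :
  exists C : R, 0 < C /\
  forall (n : nat) (f : 'rV[R]_n -> R) (L mu : R) (xs x0 : 'rV[R]_n)
         (m : nat) (beta : 'I_m -> R) (bt bh gamma : R)
         (x : nat -> 'rV[R]_n) (eps : R),
    smooth L f -> 0 <= mu -> strongly_convex mu f -> is_minimizer f xs ->
    (1 <= m)%N -> (forall i, 0 <= beta i < 1) ->
    0 <= bt < 1 -> 0 <= bh < 1 ->
    m%:R^-1 * (\sum_(i < m) beta i / (1 - beta i) ^+ 2) = bt / (1 - bt) ^+ 2 ->
    m%:R^-1 * (\sum_(i < m) (1 - beta i)^-1) = (1 - bh)^-1 ->
    gamma%:E = aggHB_stepsize L mu (beta_max beta) bt bh ->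
    is_AggHB f (fun=> gamma) beta x0 x ->
    0 < eps ->
    let R0 := norm2 (x0 - xs) in
    let F := m%:R^-1 * \sum_(i < m) gamma / (1 - beta i) in
    (0 < mu -> forall K : nat,
       C * bound_strongly_convex L mu (beta_max beta) bt bh R0 eps <= K%:R ->
       f (weighted_avg mu F x K) - f xs <= eps) /\
    (mu = 0 -> forall K : nat,
       C * bound_convex L (beta_max beta) bt bh R0 eps <= K%:R ->
       f (weighted_avg mu F x K) - f xs <= eps).
Proof.
exists 84; split=> // n f L mu xs x0 m beta bt bh gamma x eps fL mu0 fmu xs_min
  m1 beta01 bt01 /andP[bh0 bh1] SE HE gammaE agg eps0 R0 F.
(* In dimension 0 smoothness does not restrict [L], but all points coincide and the gap is 0. *)
case: n => [|n] in f xs x0 x fL fmu xs_min agg R0 *.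
  by split=> _ K _; rewrite [weighted_avg _ _ _ _]thinmx0 [xs]thinmx0 subrr ltW.
have muL := strongly_convex_le_smooth fL mu0 fmu.
(* If [L = 0] then [mu = 0], all three terms of the minimum are [+oo], and no real [gamma] equals
   it. *)
have L0 : 0 < L.
  rewrite lt_neqAle (smooth_ge0 fL) andbT; apply/eqP => L0.
  have mu_eq0 : mu = 0 by apply/eqP; rewrite eq_le mu0 andbT L0.
  have bt1 : 0 < 1 - bt by case/andP: bt01 => _; rewrite subr_gt0.
  have bm1 : 0 < 1 - beta_max beta by rewrite subr_gt0 beta_max_lt1.
  have bh2 : 0 < 1 - bh by rewrite subr_gt0.
  move: gammaE; rewrite /aggHB_stepsize -L0 mu_eq0 !mulr0 !mul0r.
  by rewrite !ereal_div_EFin ?eqxx ?minxx ?mulr_gt0 ?sqrtr_gt0 ?mulr_gt0 ?exprn_gt0.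
have bm1 := beta_max_lt1 beta beta01.
have bm_ge i := beta_max_ge beta i.
set bm := beta_max beta in bm1 bm_ge gammaE *.
have dbm : 0 < 1 - bm by rewrite subr_gt0.
have dbh : 0 < 1 - bh by rewrite subr_gt0.
have dbt : 0 < 1 - bt by case/andP: bt01 => _; rewrite subr_gt0.
have db i : 0 < 1 - beta i by case/andP: (beta01 i) => _; rewrite subr_gt0.
have b0 i : 0 <= beta i by case/andP: (beta01 i).
have g0 := stepsize_gt0 L0 mu0 bm1 bt01 bh1 gammaE.
have g_mu := stepsize_mu mu0 bm1 gammaE.
have g_L := stepsize_L L0 bh1 gammaE.
have g_bt := stepsize_bt L0 bm1 bt01 bh1 gammaE (ltW g0).
have g_low := stepsize_lower L0 mu0 bm1 bt01 bh1 gammaE.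
pose c : R := m%:R^-1; pose H := (1 - bh)^-1; pose S := bt / (1 - bt) ^+ 2.
have c0 : 0 <= c by rewrite invr_ge0.
have H0 : 0 < H by rewrite invr_gt0.
have H1 : H * (1 - bh) = 1 by rewrite mulVf // gt_eqF.
have HE' : \sum_i c / (1 - beta i) = H by rewrite /H -HE mulr_sumr.
have SE' : \sum_i c * (beta i / (1 - beta i) ^+ 2) = S.
  by rewrite /S -SE mulr_sumr.
have FE : F = gamma * H by rewrite /F -mulr_sumr mulrCA HE.
have H_le : H * (1 - bm) <= 1.
  rewrite [leRHS](_ : 1 = \sum_(i < m) c); last first.
    by rewrite sumr_const card_ord /c -[RHS]mulr_natl divff // pnatr_eq0 -lt0n.
  rewrite -HE' mulr_suml; apply: ler_sum => i _.
  rewrite -mulrA ler_piMr // mulrC ler_pdivrMr // mul1r lerD2l lerN2.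
  exact: bm_ge.
(* Termwise this reduces to [beta i (1 - bm) <= 1 - beta i]. *)
have S_le : S * (1 - bm) <= H.
  rewrite -SE' -HE' mulr_suml; apply: ler_sum => i _.
  rewrite -mulrA; apply: ler_wpM2l => //.
  have -> : (1 - beta i)^-1 = (1 - beta i) / (1 - beta i) ^+ 2.
    by field; rewrite gt_eqF.
  rewrite mulrAC; apply: ler_wpM2r.
    by rewrite invr_ge0 exprn_ge0 // ltW.
  apply: (@le_trans _ _ (1 - bm)); last by rewrite lerD2l lerN2.
  by apply: ler_piMl; apply: ltW => //; case/andP: (beta01 i).
have g_H : 4 * L * gamma * H <= 1.
  by have := ler_wpM2r (ltW H0) g_L; rewrite [X in _ <= X]mulrC H1.
(* The third stepsize term bounds [48 (L gamma S)^2] by [(1 - bh) (1 - bm) S <= (1 - bh) H = 1]. *)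
have g_S : 48 * (L * gamma * S) ^+ 2 <= 1.
  have S0 : 0 <= S by rewrite divr_ge0 ?exprn_ge0 ?(ltW dbt) //; case/andP: bt01.
  have btE : bt = (1 - bt) ^+ 2 * S by rewrite mulrC divfK // gt_eqF ?exprn_gt0.
  have h1 : 48 * (L * gamma) ^+ 2 * S <= (1 - bh) * (1 - bm).
    rewrite -(ler_pM2l (exprn_gt0 2 dbt)); apply: le_trans g_bt.
    by rewrite [in leRHS]btE mulrCA.
  have h2 := ler_wpM2r S0 h1.
  have h3 := ler_wpM2r (ltW dbh) S_le.
  lra.
(* One factor [1 - bm] of the first stepsize term cancels [H]; the other yields the margin [q_beta],
   as [1 - bm <= 1 - beta i]. *)
have q_le : mu * (gamma * H) / 2 <= (1 - bm) / 4.
  have h1 := ler_wpM2r (ltW H0) g_mu.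
  have h2 := ler_wpM2l (ltW dbm) H_le.
  lra.
have qb i : 3 / 4 * (1 - beta i) <= 1 - mu * (gamma * H) / 2 - beta i.
  by have := bm_ge i; lra.
have q0 : 0 < 1 - mu * (gamma * H) / 2.
  by have := qb (Ordinal m1); have := b0 (Ordinal m1); have := db (Ordinal m1); lra.
have [V [x0E V0 VS xS]] := aggHB_shift agg.
have gap K := weighted_avg_gap L0 mu0 g0 c0 fL fmu xs_min beta01 V0 VS xS
  HE' SE' g_H qb muL (ltW H0) g_S q0 K.
have gap_le K := weighted_avg_gap_le L0 mu0 g0 c0 fL fmu xs_min beta01 V0 VS xS
  HE' g_H q0 K.
rewrite FE; set F' := gamma * H.
have F0 : 0 < F' by rewrite mulr_gt0.
have rE : dotp (x 0%N - xs) (x 0%N - xs) = R0 ^+ 2 by rewrite x0E norm2_sqr.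
have r0 : 0 <= R0 ^+ 2 by rewrite sqr_ge0.
have d0 K : 0 <= f (weighted_avg mu F' x K) - f xs by rewrite subr_ge0.
set X := (1 - bh) / (1 - bm) ^+ 2 in g_low.
set Y := L * Num.sqrt _ / _ in g_low.
have X0 : 0 <= X by rewrite divr_ge0 ?exprn_ge0 // ltW.
have Y0 : 0 <= Y by rewrite divr_ge0 // mulr_ge0 ?sqrtr_ge0 // ltW.
have FT : 1 <= 7 * F' * (mu * X + L + Y).
  have := ler_wpM2r (ltW H0) g_low; rewrite [X in X <= _]mulrC H1 /F'; lra.
split=> [mu_gt0 K KB|mu_eq0 K KB].
  have bE : bound_strongly_convex L mu bm bt bh R0 eps =
      (mu * X + L + Y) / mu * ln (R0 ^+ 2 / eps * (L + X + Y)).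
    rewrite /bound_strongly_convex -/X -/Y; congr (_ * _).
    by rewrite /Y; field; rewrite !gt_eqF ?sqrtr_gt0.
  rewrite bE in KB.
  apply: (linear_rate R L mu F' (mu * X + L + Y) _ (R0 ^+ 2) eps _ K) KB => //.
  - by move: q0; rewrite subr_gt0.
  - by rewrite -rE.
  - by rewrite -rE.
  have -> : eps * (R0 ^+ 2 / eps * (L + X + Y)) = (L + X + Y) * R0 ^+ 2.
    by field; rewrite gt_eqF.
  by rewrite ler_wpM2r // -addrA lerDl addr_ge0.
have bE : bound_convex L bm bt bh R0 eps = R0 ^+ 2 / eps * (L + Y).
  rewrite /bound_convex /Y -!mulrA !invfM; ring.
rewrite bE in KB.
apply: (sublinear_rate R F' (L + Y) (R0 ^+ 2) eps _ K) KB => //.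
  by have := gap K; rewrite rE mu_eq0 weight_sum0.
by move: FT; rewrite mu_eq0 mul0r add0r.
Qed.
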